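(* Let $(\mu,\ell,\mathcal{W},\mathcal{A})$ be a learning tuple and let $n\ge1$, with sample $\mathcal{S}_n=(Z_1,\dots,Z_n)$ i.i.d. from $\mu$ and output hypothesis $W$ of $\mathcal{A}$ on $\mathcal{S}_n$. Let $0<c<1$ and let $v:[0,\infty)\to[0,\infty)$ be a bounded non-decreasing function with $v(\epsilon)>0$ for all $\epsilon>0$. Assume that the learning tuple satisfies the $(v,c)$-central condition. Then for any $\epsilon\ge 0$ and any $0<\eta'\le v(\epsilon)$, $$\mathbb{E}_{W\mathcal{S}_n}\left[\mathcal{E}(W,\mathcal{S}_n)\right]\le \frac{1-c}{c}\,\mathbb{E}_{P_{W\mathcal{S}_n}}\left[\hat{\mathcal{R}}(W,\mathcal{S}_n)\right]+\frac1n\sum_{i=1}^n\left(\frac{1}{\eta' c}I(W;Z_i)+\frac{\epsilon}{c}\right).$$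
   Context: Setting. $\mathcal{Z}$ is the instance space, $\mu$ a probability distribution on $\mathcal{Z}$, $\mathcal{W}$ the hypothesis space, $\ell:\mathcal{W}\times\mathcal{Z}\to\mathbb{R}$ a loss function. The sample $\mathcal{S}_n=(Z_1,\dots,Z_n)$ consists of i.i.d. draws from $\mu$. A (possibly randomised) algorithm $\mathcal{A}:\mathcal{Z}^n\to\mathcal{W}$, i.e. a conditional distribution $P_{W|\mathcal{S}_n}$, produces the hypothesis $W$. The tuple $(\mu,\ell,\mathcal{W},\mathcal{A})$ is called a learning tuple. $P_{W\mathcal{S}_n}$ is the induced joint law of $(W,\mathcal{S}_n)$, $P_{WZ_i}$ the induced joint law of $(W,Z_i)$, and $P_W$ the induced marginal law of $W$. Under $P_W\otimes\mu$, $W\sim P_W$ and $Z\sim\mu$ are independent. $\mathbb{E}_{W\mathcal{S}_n}=\mathbb{E}_{P_{W\mathcal{S}_n}}$ denotes expectation under $P_{W\mathcal{S}_n}$. Definitions. $w^*\in\arg\min_{w\in\mathcal{W}}\mathbb{E}_{Z\sim\mu}[\ell(w,Z)]$ is an optimal hypothesis; $r(w,z)=\ell(w,z)-\ell(w^*,z)$. Generalization error: $\mathcal{E}(w,\mathcal{S}_n)=\mathbb{E}_{Z\sim\mu}[\ell(w,Z)]-\frac1n\sum_{i=1}^n\ell(w,Z_i)$. Empirical excess risk: $\hat{\mathcal{R}}(w,\mathcal{S}_n)=\frac1n\sum_{i=1}^n r(w,Z_i)$. $I(W;Z_i)=D(P_{WZ_i}\,\|\,P_W\otimes\mu)$ is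 the mutual information (KL divergence, natural logarithm). $(v,c)$-central condition: for all $\epsilon\ge0$, the inequality $$\log\mathbb{E}_{P_W\otimes\mu}\left[e^{-\eta(\ell(W,Z)-\ell(w^*,Z))}\right]\le -c\,\eta\,\mathbb{E}_{P_W\otimes\mu}\left[\ell(W,Z)-\ell(w^*,Z)\right]+\eta\epsilon$$ holds with $\eta=v(\epsilon)$. *)

(* Defs.v *)
From HB Require Import structures.
From mathcomp Require Import all_boot all_order all_algebra.
From mathcomp Require Import all_classical all_reals all_analysis measurable_realfun.

Set Implicit Arguments.
Unset Strict Implicit.
Unset Printing Implicit Defensive.

Import Order.TTheory GRing.Theory Num.Theory.
Import numFieldNormedType.Exports.

Local Open Scope classical_set_scope.
Local Open Scope ring_scope.
Local Open Scope ereal_scope.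
Local Open Scope charge_scope.

Definition tcons d (T : measurableType d) n (p : T * n.-tuple T)
  : n.+1.-tuple T := [tuple of p.1 :: p.2].

Section tcons_measurable.
Context d (T : measurableType d) (n : nat).

Let measurable_tcons : measurable_fun [set: T * n.-tuple T] (@tcons d T n).
Proof. exact: measurable_cons. Qed.

HB.instance Definition _ := isMeasurableFun.Build _ _ _ _ (@tcons d T n)
  measurable_tcons.
End tcons_measurable.

(* The n-fold product measure [mu ^ n]; see [iid_lawE]. *)
Fixpoint iid_law d (T : measurableType d) (R : realType)
    (mu : probability T R) (n : nat) : probability (n.-tuple T) R :=
  match n with
  | 0 => \d_([tuple] : 0.-tuple T)
  | m.+1 => distribution (mu \x iid_law mu m) (@tcons d T m)
  end.

Section joint_law.
Context d d' (S : measurableType d) (W : measurableType d') (R : realType).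
Variables (P : probability S R) (A : R.-pker S ~> W).

(* The law of (w, s) when s is drawn from P, and then w from A s. *)
Definition joint_law (B : set (W * S)) : \bar R :=
  \int[P]_s A s [set w | B (w, s)].

Lemma joint_law_measurable_section (B : set (W * S)) (s : S) : measurable B ->
  measurable [set w | B (w, s)].
Proof.
move=> mB; rewrite (_ : [set w | _] = ysection B s); last first.
  by apply/seteqP; split=> w /=; rewrite /ysection/= inE.
exact: measurable_ysection.
Qed.

Lemma joint_law_measurable (B : set (W * S)) : measurable B ->
  measurable_fun [set: S] (fun s => A s [set w | B (w, s)]).
Proof.
move=> mB.
rewrite [X in measurable_fun _ X](_ : _ =
    fun s => \int[A s]_w (\1_B (w, s))%:E); last first.
  apply/funext => s; rewrite (_ : (fun w => _) =
    fun w => (\1_[set w | B (w, s)] w)%:E) ?integral_indic ?setIT//.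
  exact: joint_law_measurable_section.
pose k (sw : S * W) : \bar R := (\1_B (sw.2, sw.1))%:E.
apply: (@measurable_fun_integral_finite_kernel _ _ _ _ _ k A) => [sw|].
  by rewrite lee_fin.
apply/measurable_EFinP; apply: (measurableT_comp (measurable_indic mB)).
exact: measurable_swap.
Qed.

Let joint_law0 : joint_law set0 = 0.
Proof. by apply: integral0_eq => s _; rewrite -[RHS](measure0 (A s)). Qed.

Let joint_law_ge0 B : 0 <= joint_law B.
Proof. by apply: integral_ge0. Qed.

Let joint_law_sigma_additive : semi_sigma_additive joint_law.
Proof.
move=> F mF tF mUF; rewrite /joint_law.
rewrite [X in _ --> X](_ : _ =
    \sum_(k <oo) \int[P]_s A s [set w | F k (w, s)]).
  by apply: is_cvg_ereal_nneg_natsum => k _; exact: integral_ge0.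
rewrite -integral_nneseries//; last by move=> k; exact: joint_law_measurable.
apply: eq_integral => s _.
rewrite (_ : [set w | _] = \bigcup_k [set w | F k (w, s)])//.
rewrite measure_bigcup//.
- by apply: eq_eseriesl => k; rewrite in_setT.
- by move=> k _; exact: joint_law_measurable_section.
- apply/trivIsetP => i j _ _ ij.
  move/trivIsetP : tF => /(_ i j Logic.I Logic.I ij) /seteqP[tF _].
  by apply/seteqP; split=> // w []/= Fi Fj; apply: (tF (w, s)).
Qed.

HB.instance Definition _ := isMeasure.Build _ _ _ joint_law
  joint_law0 joint_law_ge0 joint_law_sigma_additive.

Let joint_law_setT : joint_law [set: W * S] = 1.
Proof.
rewrite /joint_law (_ : (fun _ => _) = cst 1); last first.
  by apply/funext => s; exact: prob_kernel.
by rewrite integral_cst// mul1e; exact: probability_setT.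
Qed.

HB.instance Definition _ := Measure_isProbability.Build _ _ _ joint_law
  joint_law_setT.

End joint_law.

HB.instance Definition _ d d' (T : measurableType d) (T' : measurableType d') :=
  isMeasurableFun.Build _ _ _ _ (@fst T T') measurable_fst.

Definition hyp_coord d d' (Z : measurableType d) (W : measurableType d')
    (n : nat) (i : 'I_n) (p : W * n.-tuple Z) : W * Z := (p.1, tnth p.2 i).

Section hyp_coord_measurable.
Context d d' (Z : measurableType d) (W : measurableType d').
Variables (n : nat) (i : 'I_n).

Let measurable_hyp_coord :
  measurable_fun [set: W * n.-tuple Z] (@hyp_coord d d' Z W n i).
Proof.
apply/measurable_fun_pairP; split; first exact: measurable_fst.
exact: (measurableT_comp (measurable_tnth i) measurable_snd).
Qed.

HB.instance Definition _ := isMeasurableFun.Build _ _ _ _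
  (@hyp_coord d d' Z W n i) measurable_hyp_coord.
End hyp_coord_measurable.

(* D(P || Q), in nats; lne 0 = -oo only matters on a P-null set. *)
Definition kl_divergence d (T : measurableType d) (R : realType)
    (P Q : probability T R) : \bar R :=
  if `[< P `<< Q >] then
    \int[P]_x lne (('d (charge_of_finite_measure P) '/d Q) x)
  else +oo.

Section learning.
Context d d' (Z : measurableType d) (W : measurableType d') (R : realType).
Variables (mu : probability Z R) (l : W -> Z -> R) (wstar : W).
Variables (n : nat) (A : R.-pker (n.-tuple Z) ~> W).

Definition law_WS : probability (W * n.-tuple Z)%type R :=
  joint_law (iid_law mu n) A.

Definition law_W : probability W R := distribution law_WS fst.

Definition law_WZ (i : 'I_n) : probability (W * Z)%type R :=
  distribution law_WS (@hyp_coord d d' Z W n i).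

Definition law_indep : probability (W * Z)%type R := law_W \x mu.

Definition mutual_info (i : 'I_n) : \bar R :=
  kl_divergence (law_WZ i) law_indep.

Definition optimal_hypothesis : Prop :=
  forall w, 'E_mu[l wstar] <= 'E_mu[l w].

Definition excess_loss (w : W) (z : Z) : R := (l w z - l wstar z)%R.

(* Extended-real valued: a non-optimal w may have infinite risk. *)
Definition gen_error (w : W) (s : n.-tuple Z) : \bar R :=
  'E_mu[l w] - (n%:R^-1 * \sum_(i < n) l w (tnth s i))%:E.

Definition emp_excess_risk (w : W) (s : n.-tuple Z) : R :=
  (n%:R^-1 * \sum_(i < n) excess_loss w (tnth s i))%R.

Definition central_condition (v : R -> R) (c : R) : Prop :=
  forall eps : R, (0 <= eps)%R -> let eta := v eps in
    lne 'E_law_indep[fun p => expR (- eta * excess_loss p.1 p.2)] <=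
    (- c * eta)%:E * 'E_law_indep[fun p => excess_loss p.1 p.2]
      + (eta * eps)%:E.

End learning.

Section iid_lawE.
Context d (T : measurableType d) (R : realType) (mu : probability T R).

Lemma iid_lawE n (B : 'I_n -> set T) : (forall i, measurable (B i)) ->
  iid_law mu n [set s | forall i, B i (tnth s i)] = \prod_(i < n) mu (B i).
Proof.
elim: n B => [|n IH] B mB.
  rewrite big_ord0 /= /dirac/= indicE mem_set//.
  by case.
rewrite big_ord_recl -IH//= /distribution/= /pushforward/=.
rewrite -product_measure1E//; last first.
  rewrite (_ : [set s | _] =
      \bigcap_i ((fun s : n.-tuple T => tnth s i) @^-1` B (lift ord0 i))).
    apply: fin_bigcap_measurable; first exact: finite_finset.
    by move=> i _; rewrite -[X in measurable X]setTI; exact: measurable_tnth.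
  by apply/seteqP; split=> s /= h i; [move=> _|]; apply: h.
congr (_ _); apply/seteqP; split=> -[x s]/=.
  move=> h; split=> [|i]; first exact: (h ord0).
  by have := h (lift ord0 i); rewrite /tcons tnthS.
case=> h0 h i; case: (unliftP ord0 i) => [j ->|->//].
by rewrite /tcons tnthS.
Qed.

End iid_lawE.

(* Main.v *)
(* Since each Z_i has law mu, the expected generalization error is the expected
   excess risk under P_W x mu minus the expected empirical excess risk, so it
   suffices to bound the former. Jensen's inequality carries the central
   condition from eta = v eps down to any eta' <= eta: the function
   h = - eta' r + eta' (c E[r] - eps) satisfies E[e^h] <= 1 under P_W x mu.
   The Donsker-Varadhan inequality then gives E[h(W, Z_i)] <= I(W; Z_i), and
   averaging over i yields the claim.

   The single terms r(W, Z_i) are not assumed integrable, only their average is.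
   So Donsker-Varadhan is used through an integrable majorant of h whose
   expectation is at most I(W; Z_i): only the sum over i of the h(W, Z_i),
   which is integrable, is ever integrated. If some I(W; Z_i) is infinite, the
   right-hand side is +oo. *)
Require Import Defs.
From HB Require Import structures.
From mathcomp Require Import all_boot all_order all_algebra.
From mathcomp Require Import all_classical all_reals all_analysis measurable_realfun.
From mathcomp Require Import ring lra.

Set Implicit Arguments.
Unset Strict Implicit.
Unset Printing Implicit Defensive.

Import Order.TTheory GRing.Theory Num.Theory.
Import numFieldNormedType.Exports.

Local Open Scope classical_set_scope.
Local Open Scope ring_scope.
Local Open Scope ereal_scope.

(** * Measurability of [lne], and integrals of functions with an integrable minorant *)

Lemma measurable_lne (R : realType) : measurable_fun [set: \bar R] (@lne R).
Proof.
rewrite [X in measurable_fun _ X](_ : _ = fun x => if x <= 0 then -oo else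
    if +oo <= x then +oo else (ln (fine x))%:E); last first.
  apply/funext => -[r| |].
  - by rewrite lee_fin leye_eq.
  - by rewrite leey leye_eq.
  - by rewrite leNye.
apply: measurable_fun_ifT.
  exact: measurable_fun_lee.
apply: measurable_cst.
apply: measurable_fun_ifT => //.
  exact: measurable_fun_lee.
by apply/measurable_EFinP; apply: measurableT_comp.
Qed.

Section integrable_minorant.
Context d (T : measurableType d) (R : realType).
Variables (mu : {measure set T -> \bar R}) (f a : T -> \bar R).
Hypotheses (mf : measurable_fun [set: T] f) (ia : mu.-integrable [set: T] a).
Hypothesis af : forall x, a x <= f x.

Let integral_funeneg_fin_num : \int[mu]_x f^\- x \is a fin_num.
Proof.
rewrite ge0_fin_numE; last exact: integral_ge0.
apply: le_lt_trans (integral_funeneg_lt_pinfty measurableT ia).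
apply: ge0_le_integral => //; first exact: measurable_funeneg.
  by apply: measurable_funeneg; exact: measurable_int ia.
by move=> x _; apply: (@funeneg_le _ _ setT); [move=> y _; exact: af|rewrite inE].
Qed.

(** From [a <= f] follows [f^\- <= a^\-], so the negative part of [f] has a finite integral and only
    the positive part can be infinite. *)
Lemma integral_gtNy : -oo < \int[mu]_x f x.
Proof.
rewrite integralE (@lt_le_trans _ _ (- \int[mu]_x f^\- x))//.
  by rewrite ltNye_eq fin_numN integral_funeneg_fin_num.
by rewrite leeDr// integral_ge0.
Qed.

(** As the integral of [f^\-] is finite, an upper bound on the integral of [f] bounds that of
    [f^\+], and [|f|] is the sum of both parts. *)
Lemma integrable_of_minorant :
  \int[mu]_x f x < +oo -> mu.-integrable [set: T] f.
Proof.
rewrite integralE lteBlDr// => f_lty; apply/integrableP; split => //.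
rewrite -[fun x => _]/(abse \o f) fune_abse ge0_integralD//.
- rewrite lte_add_pinfty//.
    apply: lt_le_trans f_lty _; exact: leey.
  by rewrite -ge0_fin_numE// integral_ge0.
- exact: measurable_funepos.
- exact: measurable_funeneg.
Qed.

End integrable_minorant.

(** * Change of measure and the Donsker-Varadhan inequality *)

Section kl_divergence_bounds.
Local Open Scope charge_scope.
Context d (T : measurableType d) (R : realType).
Variables P Q : probability T R.

(** Here [s] is a real-valued log-density of P with respect to Q. Passing from P to Q multiplies the
    integrand by e^s where the density is positive, which leaves e^h there. The last clause is only
    an inequality because Q may charge the set where the density vanishes. *)
Lemma kl_divergence_log_density : P `<< Q ->
  exists s : T -> R, [/\ measurable_fun [set: T] s,
    kl_divergence P Q = \int[P]_x (s x)%:E &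
    forall h : T -> R, measurable_fun [set: T] h ->
      \int[P]_x (expR (h x - s x))%:E <= \int[Q]_x (expR (h x))%:E].
Proof.
move=> PQ.
(* This version of the density is nonnegative and finite at every point, so its logarithm can be
   taken in the reals. *)
pose rho := Radon_Nikodym_SigmaFinite.f P Q.
have rho_ge0 x : 0 <= rho x by exact: Radon_Nikodym_SigmaFinite.f_ge0.
have rho_fin x : rho x \is a fin_num by exact: Radon_Nikodym_SigmaFinite.f_fin_num.
have mrho : measurable_fun [set: T] rho.
  exact: measurable_int (Radon_Nikodym_SigmaFinite.f_integrable PQ).
(* [ln 0 = 0], which is harmless since [rho] vanishes only on a P-null set. *)
pose s x := ln (fine (rho x)).
have ms : measurable_fun [set: T] s.
  by apply: measurableT_comp => //; apply: measurableT_comp.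
exists s; split => //.
- rewrite /kl_divergence asboolT//; apply: ae_eq_integral => //.
  + apply: measurableT_comp; first exact: measurable_lne.
    by apply: (measurable_int Q); exact: Radon_Nikodym_integrable.
  + exact/measurable_EFinP.
  (* Both versions of the density agree Q-almost everywhere, hence P-almost everywhere by
     domination. *)
  + have rhoE : ae_eq P setT rho ('d (charge_of_finite_measure P) '/d Q).
      apply: (null_dominates_ae_eq _ PQ) => //.
      exact: ae_eq_Radon_Nikodym_SigmaFinite.
    (* P gives the zero set of [rho] the Q-integral of [rho] over that set, which is 0. *)
    have rho0 : {ae P, forall x, rho x != 0}.
      exists (rho @^-1` [set 0]); split.
      * by rewrite -[X in measurable X]setTI; exact: mrho.
      * rewrite (Radon_Nikodym_SigmaFinite.f_integral PQ)//.
          by apply: integral0_eq => x.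
        by rewrite -[X in measurable X]setTI; exact: mrho.
      * by move=> x /= /negP; rewrite negbK => /eqP.
    apply: filterS2 rhoE rho0 => x /= + rho0 _ => /(_ Logic.I) <-.
    rewrite -[in LHS](fineK (rho_fin x)) lne_EFin// fine_gt0//.
    by rewrite lt_neqAle eq_sym rho0 rho_ge0 ltey_eq rho_fin.
- move=> h mh.
  have mhs : measurable_fun setT (fun x => (expR (h x - s x))%:E).
    by apply/measurable_EFinP; apply: measurableT_comp => //; exact: measurable_funB.
  rewrite -(Radon_Nikodym_SigmaFinite.change_of_variables PQ) => //.
  apply: ge0_le_integral => //.
  + by move=> x _; rewrite mule_ge0// lee_fin expR_ge0.
  + exact: emeasurable_funM.
  + by apply/measurable_EFinP; exact: measurableT_comp.
  + move=> x _; rewrite -[X in _ * X](fineK (rho_fin x)) -EFinM lee_fin /s.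
    have [->|r0] := eqVneq (rho x) 0; first by rewrite mulr0 expR_ge0.
    rewrite expRB lnK ?mulfVK ?fine_eq0// posrE fine_gt0//.
    by rewrite lt_neqAle eq_sym r0 rho_ge0 ltey_eq rho_fin.
Qed.

(** The case h = 0 of the hypothesis bounds the P-integral of e^(-s) by the mass of Q. Since 1 -
    e^(-s) <= s, this provides an integrable minorant of the log-density. *)
Lemma minorant_log_density (s : T -> R) : measurable_fun [set: T] s ->
    (forall h : T -> R, measurable_fun [set: T] h ->
      \int[P]_x (expR (h x - s x))%:E <= \int[Q]_x (expR (h x))%:E) ->
  P.-integrable [set: T] (fun x => (1 - expR (- s x))%:E).
Proof.
move=> ms /(_ (cst 0%R) (measurable_cst _)) /=.
rewrite expR0 integral_cst// mul1e => exp_le1.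
have mexp : measurable_fun [set: T] (fun x => expR (- s x)).
  by apply: measurableT_comp => //; exact: measurableT_comp.
under eq_fun do rewrite EFinB.
apply: integrableB => //.
  exact: finite_measure_integrable_cst.
apply/integrableP; split; first exact/measurable_EFinP.
under eq_integral do rewrite gee0_abs ?lee_fin ?expR_ge0//.
under eq_integral do rewrite -[X in expR X]add0r.
by rewrite (le_lt_trans exp_le1)// (le_lt_trans (probability_le1 Q _))// ltry.
Qed.

(** With this, a divergence is either finite or +oo, the two cases of the final argument. *)
Lemma kl_divergence_gtNy : -oo < kl_divergence P Q.
Proof.
have [PQ|nPQ] := pselect (P `<< Q); last first.
  by rewrite /kl_divergence asboolF// ltNyy.
have [s [ms -> /(minorant_log_density ms) smin]] := kl_divergence_log_density PQ.
apply: integral_gtNy smin _; first exact/measurable_EFinP.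
by move=> x; rewrite lee_fin; have := expR_ge1Dx (- s x); lra.
Qed.

(* The majorant [s + (e^(h - s) - 1)] comes from [1 + x <= e^x] at [x = h - s],
   [s] being the log-density of P with respect to Q. *)
Lemma kl_divergence_majorant (h : T -> R) :
    measurable_fun [set: T] h -> \int[Q]_x (expR (h x))%:E <= 1 ->
    kl_divergence P Q < +oo ->
  exists g : T -> R, [/\ P.-integrable [set: T] (EFin \o g),
    forall x, (h x <= g x)%R & \int[P]_x (g x)%:E <= kl_divergence P Q].
Proof.
move=> mh exp_le1.
have [PQ|nPQ] := pselect (P `<< Q); last first.
  by rewrite /kl_divergence asboolF// ltxx.
have [s [ms klE Ps]] := kl_divergence_log_density PQ.
rewrite klE => s_lty.
have sint : P.-integrable [set: T] (EFin \o s).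
  apply: integrable_of_minorant (minorant_log_density ms Ps) _ s_lty.
    exact/measurable_EFinP.
  by move=> x; rewrite lee_fin; have := expR_ge1Dx (- s x); lra.
have exps_le1 : \int[P]_x (expR (h x - s x))%:E <= 1.
  exact: le_trans (Ps _ mh) exp_le1.
have iexp : P.-integrable [set: T] (fun x => (expR (h x - s x))%:E).
  apply/integrableP; split.
    by apply/measurable_EFinP; apply: measurableT_comp => //; exact: measurable_funB.
  under eq_integral do rewrite gee0_abs ?lee_fin ?expR_ge0//.
  exact: le_lt_trans exps_le1 (ltry _).
have iexp1 : P.-integrable [set: T] (fun x => (expR (h x - s x) - 1)%:E).
  under eq_fun do rewrite EFinB.
  by apply: integrableB => //; exact: finite_measure_integrable_cst.
exists (fun x => s x + (expR (h x - s x) - 1))%R; split.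
- by under [X in _.-integrable _ X]eq_fun do rewrite /= EFinD; exact: integrableD.
- by move=> x; have := expR_ge1Dx (h x - s x); lra.
(* The correction e^(h - s) - 1 has nonpositive mean by [exps_le1], so adding it to [s] does not
   raise the expectation. *)
- under eq_integral do rewrite EFinD.
  rewrite integralD//= -[leRHS]adde0 leeD//.
  under eq_integral do rewrite EFinB.
  rewrite integralB//; last exact: finite_measure_integrable_cst.
  by rewrite integral_cst//= probability_setT mule1 sube_le0.
Qed.

End kl_divergence_bounds.

(** * Jensen's inequality for exponential moments, from pointwise convexity *)

Lemma expR_le_chord (R : realType) (t u : R) : (0 <= t <= 1)%R ->
  (expR (t * u) <= 1 - t + t * expR u)%R.
Proof.
move=> /andP[t0 t1].
(* Both tangent bounds are taken at [t * u]; their convex combination eliminates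
   the slope. *)
have h1 : (expR (t * u) * (1 + (1 - t) * u) <= expR u)%R.
  rewrite [X in (_ <= expR X)%R](_ : _ = t * u + (1 - t) * u)%R; last by ring.
  by rewrite expRD ler_wpM2l ?expR_ge0// expR_ge1Dx.
have h2 : (expR (t * u) * (1 - t * u) <= 1)%R.
  rewrite -[leRHS]expR0 -[X in (_ <= expR X)%R](subrr (t * u)%R) expRD.
  by rewrite ler_wpM2l ?expR_ge0// expR_ge1Dx.
have := ler_wpM2l t0 h1; have := ler_wpM2l (_ : 0 <= 1 - t)%R h2.
rewrite subr_ge0 t1 => /(_ isT); lra.
Qed.

(** The hypothesis says E[e^(g - b)] <= 1. Integrating the chord bound at u = g - b gives at most (1
    - t) + t = 1. With t = eta' / eta this lowers the parameter of the central condition from eta to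
    eta'. *)
Lemma integral_expR_tempered d (T : measurableType d) (R : realType)
    (Q : probability T R) (g : T -> R) (t b : R) :
    measurable_fun [set: T] g -> (0 <= t <= 1)%R ->
    lne (\int[Q]_x (expR (g x))%:E) <= b%:E ->
  \int[Q]_x (expR (t * (g x - b)))%:E <= 1.
Proof.
move=> mg t01; have /andP[t0 t1] := t01.
have int_ge0 : 0 <= \int[Q]_x (expR (g x))%:E.
  by apply: integral_ge0 => x _; rewrite lee_fin expR_ge0.
(* On nonnegative extended reals [expeR] inverts [lne], including at 0 and +oo. *)
rewrite -lee_expeR lneK ?in_itv/= ?int_ge0 ?leey// => int_le.
have mexp (k : R) : measurable_fun [set: T] (fun x => (expR (g x - k))%:E).
  by apply/measurable_EFinP/measurableT_comp => //; exact: measurable_funB.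
have int_shift_le1 : \int[Q]_x (expR (g x - b))%:E <= 1.
  under eq_integral do rewrite expRD mulrC EFinM.
  rewrite ge0_integralZl ?lee_fin ?expR_ge0//; last first.
    by apply/measurable_EFinP; exact: measurableT_comp.
  apply: le_trans (lee_wpmul2l _ int_le) _; first by rewrite lee_fin expR_ge0.
  by rewrite -EFinM -expRD addNr expR0.
apply: (@le_trans _ _ (\int[Q]_x ((1 - t)%:E + t%:E * (expR (g x - b))%:E))).
  apply: ge0_le_integral => //.
  - apply/measurable_EFinP/measurableT_comp => //.
    by apply: measurable_funM => //; exact: measurable_funB.
  - by apply: emeasurable_funD => //; exact: emeasurable_funM.
  - by move=> x _; rewrite -EFinM -EFinD lee_fin expR_le_chord.
rewrite ge0_integralD//; last 3 first.
- by rewrite lee_fin subr_ge0.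
- by move=> x _; rewrite mule_ge0// lee_fin ?expR_ge0.
- exact: emeasurable_funM.
rewrite integral_cst// ge0_integralZl//= probability_setT mule1.
rewrite (@le_trans _ _ ((1 - t)%:E + t%:E * 1))//.
  by rewrite leeD2l// lee_wpmul2l ?lee_fin.
by rewrite mule1 -EFinD subrK.
Qed.

(** * Pushforward laws, and the marginal law of each sample point *)

Lemma integrable_distribution d d' (T : measurableType d)
    (T' : measurableType d') (R : realType) (P : probability T R)
    (X : {mfun T >-> T'}) (f : T' -> \bar R) :
  (distribution P X).-integrable [set: T'] f ->
  P.-integrable [set: T] (f \o X).
Proof.
move=> /integrableP[mf f_lty]; apply/integrableP; split.
  exact: measurableT_comp.
by rewrite ge0_integral_distribution in f_lty => //; exact: measurableT_comp.
Qed.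

Lemma ae_distribution d d' (T : measurableType d)
    (T' : measurableType d') (R : realType) (P : probability T R)
    (X : {mfun T >-> T'}) (p : T' -> Prop) :
  {ae distribution P X, forall y, p y} -> {ae P, forall x, p (X x)}.
Proof.
move=> [N [mN N0 pN]]; exists (X @^-1` N); split => //.
- by rewrite -[X in measurable X]setTI; exact: measurable_funP.
- by move=> x px; exact: pN.
Qed.

Definition sample_coord d d' (Z : measurableType d) (W : measurableType d')
    (n : nat) (i : 'I_n) (p : W * n.-tuple Z) : Z := tnth p.2 i.

Section sample_coord_measurable.
Context d d' (Z : measurableType d) (W : measurableType d').
Variables (n : nat) (i : 'I_n).

Let measurable_sample_coord :
  measurable_fun [set: W * n.-tuple Z] (@sample_coord d d' Z W n i).
Proof. exact: (measurableT_comp (measurable_tnth i) measurable_snd). Qed.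

HB.instance Definition _ := isMeasurableFun.Build _ _ _ _
  (@sample_coord d d' Z W n i) measurable_sample_coord.
End sample_coord_measurable.

Section law_of_sample.
Context d d' (Z : measurableType d) (W : measurableType d') (R : realType).
Variables (mu : probability Z R) (n : nat) (A : R.-pker (n.-tuple Z) ~> W).
Variable i : 'I_n.

Lemma iid_law_tnth (B : set Z) : measurable B ->
  iid_law mu n [set s | B (tnth s i)] = mu B.
Proof.
(* The event is a box with B in slot i and the whole space in the others, each of which contributes
   a factor 1. *)
move=> mB; pose C j := if j == i then B else setT.
rewrite (_ : [set s | _] = [set s | forall j, C j (tnth s j)]); last first.
  apply/seteqP; split=> s /=; last by move=> /(_ i); rewrite /C eqxx.
  by move=> Bs j; rewrite /C; case: eqP => // ->.
rewrite iid_lawE; last by move=> j; rewrite /C; case: ifP.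
rewrite (bigD1 i)//= big1 ?mule1 /C ?eqxx// => j /negbTE ->.
exact: probability_setT.
Qed.

Lemma distribution_sample_coord (B : set Z) : measurable B ->
  distribution (law_WS mu A) (@sample_coord d d' Z W n i) B = mu B.
Proof.
move=> mB; have mBs : measurable [set s : n.-tuple Z | B (tnth s i)].
  by rewrite -[X in measurable X]setTI; exact: measurable_tnth.
rewrite -(iid_law_tnth mB) -[X in iid_law _ _ X]setIT -integral_indic//.
rewrite /distribution/= /pushforward/= /joint_law/=.
(* For fixed [s] the event does not depend on w, so its mass under the probability [A s] is 1 or
   0. *)
apply: eq_integral => s _; rewrite indicE; have [Bs|nBs] := pselect (B (tnth s i)).
  by rewrite mem_set// -(@prob_kernel _ _ _ _ _ A s); congr (A s _);
    apply/seteqP; split.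
by rewrite memNset// -[RHS](measure0 (A s)); congr (A s _); apply/seteqP; split.
Qed.

Lemma integrable_sample_coord (f : Z -> \bar R) : mu.-integrable [set: Z] f ->
  (law_WS mu A).-integrable [set: W * n.-tuple Z]
    (f \o @sample_coord d d' Z W n i).
Proof.
move=> /integrableP[mf f_lty]; apply: integrable_distribution.
apply/integrableP; split => //.
rewrite (eq_measure_integral mu)// => B mB _.
exact: distribution_sample_coord.
Qed.

Lemma integral_sample_coord (f : Z -> \bar R) : mu.-integrable [set: Z] f ->
  \int[law_WS mu A]_p f (sample_coord i p) = \int[mu]_z f z.
Proof.
move=> fi; have /integrableP[mf _] := fi.
rewrite -(integral_distribution mf (integrable_sample_coord fi)).
by apply: eq_measure_integral => B mB _; exact: distribution_sample_coord.
Qed.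

End law_of_sample.

(** * Expected generalization error in terms of excess risks *)

Section expected_gen_error.
Context d d' (Z : measurableType d) (W : measurableType d') (R : realType).
Variables (mu : probability Z R) (l : W -> Z -> R) (wstar : W).
Variables (n : nat) (A : R.-pker (n.-tuple Z) ~> W).
Hypothesis n_gt0 : (0 < n)%N.
Hypothesis ml : measurable_fun [set: W * Z] (fun p => l p.1 p.2).
Hypothesis il : mu.-integrable [set: Z] (fun z => (l wstar z)%:E).
Hypothesis ir : (law_indep mu A).-integrable [set: W * Z]
  (fun p => (excess_loss l wstar p.1 p.2)%:E).
Hypothesis iR : (law_WS mu A).-integrable [set: W * n.-tuple Z]
  (fun p => (emp_excess_risk l wstar p.1 p.2)%:E).

Let F w := \int[mu]_z (excess_loss l wstar w z)%:E.

Let avg_lstar (p : W * n.-tuple Z) :=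
  \sum_(i < n) (n%:R^-1)%:E * (l wstar (sample_coord i p))%:E.

Let iF : (law_W mu A).-integrable [set: W] F.
Proof. exact: (integrable_fubini_F ir). Qed.

Let iavg : (law_WS mu A).-integrable [set: W * n.-tuple Z] avg_lstar.
Proof.
apply: integrable_sum => // i _; apply: integrableZl => //.
exact: (integrable_sample_coord A i il).
Qed.

Let integral_avg :
  \int[law_WS mu A]_p avg_lstar p = \int[mu]_z (l wstar z)%:E.
Proof.
rewrite integral_sum//; last first.
  by move=> i; apply: integrableZl => //; exact: (integrable_sample_coord A i il).
rewrite (eq_bigr (fun=> (n%:R^-1)%:E * \int[mu]_z (l wstar z)%:E)); last first.
  move=> i _; rewrite integralZl//; last exact: (integrable_sample_coord A i il).
  by congr (_ * _); exact: (integral_sample_coord A i il).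
have /fineK <- := integrable_fin_num measurableT il.
rewrite -EFinM sumEFin sumr_const card_ord -mulrnAl -(mulr_natr n%:R^-1).
by rewrite mulVf ?mul1r// pnatr_eq0 -lt0n.
Qed.

Let risk_excess (w : W) :
    mu.-integrable [set: Z] (fun z => (excess_loss l wstar w z)%:E) ->
  'E_mu[l w] = F w + \int[mu]_z (l wstar z)%:E.
Proof.
move=> irw; rewrite unlock -integralD//; apply: eq_integral => z _.
by rewrite -EFinD subrK.
Qed.

Let measurable_risk : measurable_fun [set: W] (fun w => 'E_mu[l w]).
Proof.
have mlE : measurable_fun [set: W * Z] (fun p => (l p.1 p.2)%:E).
  exact/measurable_EFinP.
(* The loss may fail to be integrable for some w, so Tonelli's theorem is applied to its positive
   and negative parts separately. *)
rewrite [X in measurable_fun _ X](_ : _ = fun w =>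
    \int[mu]_z ((fun p => (l p.1 p.2)%:E)^\+ (w, z)) -
    \int[mu]_z ((fun p => (l p.1 p.2)%:E)^\- (w, z))); last first.
  apply/funext => w; rewrite unlock integralE.
  by congr (_ - _); apply: eq_integral => z _; rewrite ?funeposE ?funenegE.
apply: emeasurable_funB.
- apply: (measurable_fun_fubini_tonelli_F (fun p => (l p.1 p.2)%:E)^\+) => //.
  exact: measurable_funepos.
- apply: (measurable_fun_fubini_tonelli_F (fun p => (l p.1 p.2)%:E)^\-) => //.
  exact: measurable_funeneg.
Qed.

(** The loss of [wstar] is subtracted from both the risk and the empirical risk. Its expectation is
    the same constant in both, because each sample point has law [mu], and it cancels. *)
Lemma integral_gen_error :
  \int[law_WS mu A]_p gen_error mu l p.1 p.2 =
  'E_(law_indep mu A)[fun p => excess_loss l wstar p.1 p.2] -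
  'E_(law_WS mu A)[fun p => emp_excess_risk l wstar p.1 p.2].
Proof.
have [e lstarE] : exists e, \int[mu]_z (l wstar z)%:E = e%:E.
  by exists (fine (\int[mu]_z (l wstar z)%:E)); rewrite fineK// integrable_fin_num.
have iF1 : (law_WS mu A).-integrable [set: W * n.-tuple Z] (F \o fst).
  exact: (integrable_distribution iF).
(* [G] is a version of the generalization error whose four terms are each integrable under the joint
   law. *)
pose G p := (F p.1 + e%:E) -
  ((emp_excess_risk l wstar p.1 p.2)%:E + avg_lstar p).
have iEstar : (law_WS mu A).-integrable [set: W * n.-tuple Z]
    (fun=> e%:E).
  exact: finite_measure_integrable_cst.
have empE p : (n%:R^-1 * \sum_(i < n) l p.1 (tnth p.2 i))%:E =
    (emp_excess_risk l wstar p.1 p.2)%:E + avg_lstar p.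
  rewrite /emp_excess_risk /avg_lstar.
  under [X in _ + X]eq_bigr do rewrite -EFinM.
  rewrite sumEFin -EFinD -mulr_sumr -mulrDr -big_split/=.
  by congr (_ * _)%:E; apply: eq_bigr => i _; rewrite subrK.
rewrite (ae_eq_integral G)//.
- rewrite integralB//; last 2 first.
    exact: integrableD.
    exact: integrableD.
  rewrite integralD// integralD// integral_avg lstarE.
  rewrite integral_cst//= probability_setT mule1.
  rewrite -(@integral_distribution _ _ _ _ _ (law_WS mu A) fst F)//; last first.
    exact: measurable_int iF.
  rewrite (integral12_prod_meas1 ir) !unlock.
  have /fineK <- := integrable_fin_num measurableT ir.
  have /fineK <- := integrable_fin_num measurableT iR.
  rewrite -!EFinD; congr _%:E; ring.
- apply: emeasurable_funB.
    exact: (measurableT_comp measurable_risk).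
  under eq_fun do rewrite empE.
  apply: emeasurable_funD; first exact: measurable_int iR.
  exact: measurable_int iavg.
- apply: emeasurable_funB; apply: emeasurable_funD.
  + exact: measurable_int iF1.
  + exact: measurable_cst.
  + exact: measurable_int iR.
  + exact: measurable_int iavg.
(* By Fubini the excess loss of w is [mu]-integrable for almost every w under the law of W, and
   there the risk is [F w + e]. *)
- have := @ae_distribution _ _ _ _ _ (law_WS mu A) fst _ (ae_integrable1 ir).
  apply: filterS => p irp _.
  by rewrite /gen_error /G empE risk_excess// lstarE.
Qed.

End expected_gen_error.

(** * Bound on the expected generalization error *)

Theorem theorem5 (R : realType) (d d' : measure_display)
    (Z : measurableType d) (W : measurableType d')
    (mu : probability Z R) (l : W -> Z -> R) (wstar : W)
    (n : nat) (A : R.-pker (n.-tuple Z) ~> W)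
    (c : R) (v : R -> R)
    (n_ge1 : (1 <= n)%N)
    (ml : measurable_fun [set: W * Z] (fun p => l p.1 p.2))
    (il : mu.-integrable [set: Z] (fun z => (l wstar z)%:E))
    (wstar_opt : optimal_hypothesis mu l wstar)
    (ir : (law_indep mu A).-integrable [set: W * Z]
            (fun p => (excess_loss l wstar p.1 p.2)%:E))
    (iR : (law_WS mu A).-integrable [set: W * n.-tuple Z]
            (fun p => (emp_excess_risk l wstar p.1 p.2)%:E))
    (c_gt0 : (0 < c)%R) (c_lt1 : (c < 1)%R)
    (v_ge0 : forall e : R, (0 <= e)%R -> (0 <= v e)%R)
    (v_bounded : exists M : R, forall e : R, (0 <= e)%R -> (v e <= M)%R)
    (v_nondecr : forall e1 e2 : R, (0 <= e1)%R -> (e1 <= e2)%R ->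
                   (v e1 <= v e2)%R)
    (v_gt0 : forall e : R, (0 < e)%R -> (0 < v e)%R)
    (central : central_condition mu l wstar A v c)
    (eps eta' : R) (eps_ge0 : (0 <= eps)%R)
    (eta'_gt0 : (0 < eta')%R) (eta'_le : (eta' <= v eps)%R) :
  \int[law_WS mu A]_p gen_error mu l p.1 p.2 <=
    ((1 - c) / c)%:E *
      'E_(law_WS mu A)[fun p => emp_excess_risk l wstar p.1 p.2]
    + (n%:R^-1)%:E *
        \sum_(i < n) ((eta' * c)^-1%:E * mutual_info mu A i + (eps / c)%:E).
Proof.
have n_gt0 : (0 < n%:R :> R)%R by rewrite ltr0n.
rewrite (integral_gen_error n_ge1 ml il ir iR).
have [er erE] : exists e,
    'E_(law_indep mu A)[fun p => excess_loss l wstar p.1 p.2] = e%:E.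
  exists (fine ('E_(law_indep mu A)[fun p => excess_loss l wstar p.1 p.2])).
  by rewrite fineK// unlock; exact: integrable_fin_num ir.
have [eR eRE] : exists e,
    'E_(law_WS mu A)[fun p => emp_excess_risk l wstar p.1 p.2] = e%:E.
  exists (fine ('E_(law_WS mu A)[fun p => emp_excess_risk l wstar p.1 p.2])).
  by rewrite fineK// unlock; exact: integrable_fin_num iR.
rewrite erE eRE.
have kl_gtNy i : -oo < mutual_info mu A i by exact: kl_divergence_gtNy.
have etac_gt0 : (0 < (eta' * c)^-1)%R by rewrite invr_gt0 mulr_gt0.
have [[i kl_y]|/forallNP kl_lty] := pselect (exists i, mutual_info mu A i = +oo).
  suff -> : \sum_(i < n) ((eta' * c)^-1%:E * mutual_info mu A i + (eps / c)%:E) = +oo.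
    by rewrite gt0_muley ?lte_fin ?invr_gt0// -EFinM addey// leey.
  apply/esum_eqyP => [j _|].
    have := kl_gtNy j; case: (mutual_info mu A j) => [r| |]//= _.
    by rewrite gt0_muley ?lte_fin.
  by exists i; rewrite mem_index_enum kl_y gt0_muley ?lte_fin.
have [k kE] : exists k : 'I_n -> R, forall i, mutual_info mu A i = (k i)%:E.
  exists (fun i => fine (mutual_info mu A i)) => i; rewrite fineK//.
  by rewrite fin_numE -ltNye kl_gtNy; exact/eqP.
pose eta := v eps; pose t := (eta' / eta)%R.
(* Positivity comes from 0 < eta' <= v eps, which also covers eps = 0. *)
have eta_gt0 : (0 < eta)%R by exact: lt_le_trans eta'_le.
(* [b] is the right-hand side of the central condition. As t eta = eta', the function [h] below
   equals - eta' r + eta' (c E[r] - eps). *)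
pose b := (- c * eta * er + eta * eps)%R.
pose h p := (t * (- eta * excess_loss l wstar p.1 p.2 - b))%R.
have mr : measurable_fun [set: W * Z] (fun p => excess_loss l wstar p.1 p.2).
  by apply/measurable_EFinP; exact: measurable_int ir.
have mgr : measurable_fun [set: W * Z]
    (fun p => - eta * excess_loss l wstar p.1 p.2)%R.
  exact: measurable_funM.
have exph_le1 : \int[law_indep mu A]_p (expR (h p))%:E <= 1.
  apply: integral_expR_tempered => //.
    by rewrite ltW ?divr_gt0//= ler_pdivrMr ?mul1r.
  by have := central _ eps_ge0; rewrite /= erE unlock -EFinM -EFinD.
have mh : measurable_fun [set: W * Z] h.
  by apply: measurable_funM => //; exact: measurable_funB.
have /choice[g gP] : forall i, exists g : W * Z -> R,
    [/\ (law_WZ mu A i).-integrable [set: W * Z] (EFin \o g),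
        forall p, (h p <= g p)%R &
        \int[law_WZ mu A i]_p (g p)%:E <= (k i)%:E].
  move=> i; rewrite -kE; apply: kl_divergence_majorant => //.
  by rewrite -/(mutual_info mu A i) kE ltry.
have ig i : (law_WS mu A).-integrable [set: W * n.-tuple Z]
    (fun p => (g i (hyp_coord i p))%:E).
  by have [+ _ _] := gP i; exact: integrable_distribution.
have tbE : (t * b = eta' * (eps - c * er))%R.
  by rewrite /t /b; field; rewrite gt_eqF.
have sumhE p : (\sum_(i < n) h (hyp_coord i p) =
    n%:R * (- eta' * emp_excess_risk l wstar p.1 p.2 - t * b))%R.
  rewrite /h /emp_excess_risk.
  under eq_bigr do rewrite mulrBr mulrA.
  rewrite sumrB -mulr_sumr sumr_const card_ord -[in X in (_ - X)%R]mulr_natl.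
  rewrite [(t * - eta)%R](_ : _ = - eta')%R; last first.
    by rewrite /t; field; rewrite gt_eqF.
  by rewrite mulrBr; congr (_ - _)%R; field; rewrite gt_eqF.
have sum_le : (n%:R * (- eta' * eR - t * b) <= \sum_(i < n) k i)%R.
  rewrite -lee_fin -sumEFin.
  apply: (@le_trans _ _ (\sum_(i < n) \int[law_WZ mu A i]_p (g i p)%:E)); last first.
    by apply: lee_sum => i _; have [] := gP i.
  (* All integrals are moved to the one joint law, so that the sum can enter the integral before [g]
     is compared with [h]. *)
  rewrite (eq_bigr (fun i =>
      \int[law_WS mu A]_p (g i (hyp_coord i p))%:E)); last first.
    move=> i _; have [/(measurable_int _) mg _ _] := gP i.
    by rewrite integral_distribution//; exact: ig.
  rewrite -integral_sum//.
  have iH : (law_WS mu A).-integrable [set: W * n.-tuple Z]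
      (fun p => (- eta' * emp_excess_risk l wstar p.1 p.2 - t * b)%:E).
    under eq_fun do rewrite EFinB EFinM.
    by apply: integrableB => //; [exact: integrableZl|
      exact: finite_measure_integrable_cst].
  have -> : (n%:R * (- eta' * eR - t * b))%:E = \int[law_WS mu A]_p
      (n%:R%:E * (- eta' * emp_excess_risk l wstar p.1 p.2 - t * b)%:E).
    rewrite integralZl//; under eq_integral do rewrite EFinB EFinM.
    rewrite integralB//; last 2 first.
      exact: integrableZl.
      exact: finite_measure_integrable_cst.
    rewrite integralZl// integral_cst//= probability_setT mule1.
    by move: eRE; rewrite unlock => ->.
  apply: le_integral => //.
  - exact: integrableZl.
  - exact: integrable_sum.
  - move=> p _; rewrite -EFinM -sumhE sumEFin lee_fin.
    by apply: ler_sum => i _; have [_ + _] := gP i; exact.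
under eq_bigr do rewrite kE -EFinM -EFinD.
rewrite sumEFin -!EFinM -!EFinD lee_fin.
rewrite big_split/= -mulr_sumr sumr_const card_ord -[(_ *+ n)%R]mulr_natl.
rewrite tbE in sum_le.
(* The right-hand side minus the left-hand side is exactly the slack of [sum_le] divided by n eta'
   c. *)
rewrite -subr_ge0.
rewrite [leRHS](_ : _ = (n%:R * eta' * c)^-1 *
  (\sum_(i < n) k i - n%:R * (- eta' * eR - eta' * (eps - c * er))))%R.
  by rewrite mulr_ge0 ?subr_ge0// invr_ge0 !mulr_ge0// ltW.
by field; rewrite !gt_eqF.
Qed.
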